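(* Let $L$ be a non-negative integer, $f$ a positive integer, and for non-negative integers $n_1,\dots,n_f$ put $N_i:=n_i+n_{i+1}+\dots+n_f$ for $i=1,\dots,f$. Then \[ \sum_{m,n,n_1,\dots,n_f\geq 0}\frac{q^{2m^2+6mn+6n^2+3(N_1^2+\dots+N_f^2)}(q^3;q^3)_{2L}(q^3;q^3)_{n_f}}{(q;q)_m(q^3;q^3)_n(q^3;q^3)_{L-N_1}(q^3;q^3)_{n_f-2n-m}(q^3;q^3)_{n_1}\cdots(q^3;q^3)_{n_{f-1}}(q^3;q^3)_{2n_f}}=\sum_{j=-L}^{L}q^{3(f+1)j^2+j}{2L\brack L-j}_{q^3}. \]
   Context: $(a;q)_n=\prod_{k=0}^{n-1}(1-aq^k)$, and $(a;q^3)_n$ is defined analogously with $q$ replaced by $q^3$. By convention $1/(q;q)_n=0$ and $1/(q^3;q^3)_n=0$ for negative integers $n$, so summands with a negative index in a denominator vanish. The $q$-binomial coefficient is ${m+n\brack m}_q=\frac{(q;q)_{m+n}}{(q;q)_m(q;q)_n}$ for $m,n\ge0$ and $0$ otherwise; ${\cdot\brack\cdot}_{q^3}$ is the same with $q$ replaced by $q^3$. *)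

(* Defs.v *)
From mathcomp Require Import all_boot all_order all_algebra.
From mathcomp Require Import finmap boolp classical_sets functions cardinality.
From mathcomp Require Import fsbigop.

Set Implicit Arguments.
Unset Strict Implicit.
Unset Printing Implicit Defensive.

Import Order.TTheory GRing.Theory Num.Theory.
Local Open Scope classical_set_scope.
Local Open Scope ring_scope.

Section QSeries.
Variable F : fieldType.
Implicit Types q a : F.

Definition qpoch a q (n : nat) : F := \prod_(k < n) (1 - a * q ^+ k).

(* 1 / (q;q)_n, with the convention that it vanishes for n < 0. *)
Definition inv_qpoch q (n : int) : F :=
  if n is Posz k then (qpoch q q k)^-1 else 0.

(* [A, B]_q with A = m + n and B = m; it is 0 unless m, n >= 0. *)
Definition qbinom q (A B : int) : F :=
  match B, A - B with
  | Posz m, Posz n => qpoch q q (m + n) / (qpoch q q m * qpoch q q n)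
  | _, _ => 0
  end.

(* The tuple s = (n_1, .., n_f) is read with indices starting at 1. *)
Definition part f (s : f.-tuple nat) (i : nat) : nat := nth 0%N s i.-1.

Definition tail_sum f (s : f.-tuple nat) (i : nat) : nat :=
  (\sum_(i <= k < f.+1) part s k)%N.

Definition summand q (L f m n : nat) (s : f.-tuple nat) : F :=
  let n_ := part s in
  let N := tail_sum s in
  q ^+ (2 * m ^ 2 + 6 * m * n + 6 * n ^ 2 + 3 * \sum_(1 <= i < f.+1) N i ^ 2)
  * qpoch (q ^+ 3) (q ^+ 3) (2 * L) * qpoch (q ^+ 3) (q ^+ 3) (n_ f)
  * (inv_qpoch q m%:Z * inv_qpoch (q ^+ 3) n%:Z
     * inv_qpoch (q ^+ 3) (L%:Z - (N 1%N)%:Z)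
     * inv_qpoch (q ^+ 3) ((n_ f)%:Z - 2 * n%:Z - m%:Z)
     * \prod_(1 <= i < f) inv_qpoch (q ^+ 3) (n_ i)%:Z
     * inv_qpoch (q ^+ 3) (2 * n_ f)%:Z).

Lemma inv_qpoch_lt0 q (n : int) : n < 0 -> inv_qpoch q n = 0.
Proof. by case: n. Qed.

Lemma part_le_tail_sum f (s : f.-tuple nat) i :
  (0 < i <= f)%N -> (part s i <= tail_sum s 1)%N.
Proof.
move=> /andP[i0 lif]; rewrite /tail_sum.
by rewrite (big_cat_nat i0) ?leqW//= (big_ltn (m := i))//= addnCA leq_addr.
Qed.

Lemma summand_neq0 q L f m n (s : f.-tuple nat) : (0 < f)%N ->
  summand q L m n s != 0 -> [/\ (m <= L)%N, (n <= L)%N & forall x, x \in s -> (x <= L)%N].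
Proof.
move=> f0 nz.
have NL : (tail_sum s 1 <= L)%N.
  rewrite leqNgt; apply/negP => lt; move: nz; rewrite /summand/=.
  by rewrite (@inv_qpoch_lt0 _ (L%:Z - _)) ?subr_lt0// !(mulr0, mul0r) eqxx.
have fL : (part s f <= L)%N by rewrite (leq_trans _ NL)// part_le_tail_sum// f0 leqnn.
have mnf : (2 * n + m <= part s f)%N.
  rewrite leqNgt; apply/negP => lt; move: nz; rewrite /summand/=.
  rewrite (@inv_qpoch_lt0 _ ((part s f)%:Z - _ - _)) ?(mulr0, mul0r) ?eqxx//.
  by rewrite -addrA -opprD subr_lt0 -PoszM -PoszD.
have mnL := leq_trans mnf fL; split.
- exact: leq_trans (leq_addl _ _) mnL.
- apply: leq_trans mnL; rewrite mulSn -addnA; exact: leq_addr.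
move=> x /(nthP 0%N)[i]; rewrite size_tuple => lif <-.
by rewrite (leq_trans _ NL)// (@part_le_tail_sum _ s i.+1).
Qed.

(* Only finitely many terms of the multiple sum are nonzero, so that its
   finitely-supported rendering does not take the default value 0. *)
Lemma finite_summand q L f : (0 < f)%N ->
  finite_set [set x : nat * nat * f.-tuple nat |
              summand q L x.1.1 x.1.2 x.2 != 0].
Proof.
move=> f0.
pose h (y : 'I_L.+1 * 'I_L.+1 * f.-tuple 'I_L.+1) : nat * nat * f.-tuple nat :=
  (val y.1.1, val y.1.2, map_tuple val y.2).
apply: (@sub_finite_set _ _ (h @` setT)); last exact/finite_image/finite_finset.
move=> [[m n] s] /= /(summand_neq0 f0)[mL nL sL].
exists (inord m, inord n, map_tuple (@inord L) s) => //.
congr (_, _, _); rewrite /= ?inordK//; apply: val_inj => /=.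
rewrite -map_comp -[RHS]map_id; apply/eq_in_map => x /sL xL /=.
by rewrite inordK.
Qed.

End QSeries.

(* Main.v *)
Require Import Defs.
From mathcomp Require Import all_boot all_order all_algebra.
From mathcomp Require Import finmap boolp classical_sets functions cardinality.
From mathcomp Require Import fsbigop.
From mathcomp Require Import zify ring.

Set Implicit Arguments.
Unset Strict Implicit.
Unset Printing Implicit Defensive.

Import Order.TTheory GRing.Theory Num.Theory.
Local Open Scope classical_set_scope.
Local Open Scope ring_scope.

(** Put [Q = q^3] and write [w n] for [1/(Q;Q)_n].  By the q-Chu-Vandermonde sum
    in the limiting form
      [sum_k Q^(k(k+j)) w(k) w(k+j) w(A-k) = w(A) w(A+j)],
    one Bailey step [sum_r Q^(r^2) w(L-r)] sends [w(r-j) w(r+j)] to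
    [Q^(j^2) w(L-j) w(L+j)].  The multiple sum consists of [f] such steps, with
    [r] running over [N_1, ..., N_f], applied to the case [f = 0]:
      [sum_(m,n) q^(2m^2+6mn+6n^2) (Q)_r / ((q)_m (Q)_n (Q)_(r-2n-m))
         = sum_j q^(3j^2+j) [2r, r-j]_Q].
    For this one, split [1/(q)_m] into a sum over [a + b + c = m] of
    [w(a) w(b) w(c)] and set [b = c + j].  For each [j] the sum over [c] with
    [N = c + n] fixed is the limiting q-Chu-Vandermonde sum; those over [N] with
    [p = a + N] fixed, and then over [p], are full q-Chu-Vandermonde sums.

    Powers with integer exponents require [q <> 0]; for [q = 0] both sides
    are [1]. *)

(** * Finitely supported sums and sums over symmetric windows of integers *)

Lemma fsbig_inj (V : nmodType) (I : finType) (T : choiceType) (D : set T)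
    (h : I -> T) (G : T -> V) :
  injective h -> (forall i, D (h i)) ->
  (forall x, D x -> (forall i, h i <> x) -> G x = 0) ->
  \sum_(x \in D) G x = \sum_i G (h i).
Proof.
move=> hI hD G0; rewrite (fsbigE (map h (enum I))).
- rewrite big_map big_enum_cond/=; apply: eq_bigl => i.
  by apply/idP; rewrite inE.
- by rewrite map_inj_uniq ?enum_uniq.
- by move=> x /= /mapP[i _ ->].
- move=> x Dx /negP nx; apply: G0 => // i hix; apply: nx.
  by rewrite -hix map_f ?mem_enum.
Qed.

(** One window [[-B, B]] serves all indices, of either sign: the summands vanish outside it because
    some [inv_qpoch] has a negative index. Shifts and reflections then need no change of bounds. *)
Definition zsum (V : nmodType) (B : nat) (H : int -> V) : V :=
  \sum_(i < (2 * B).+1) H (i%:Z - B%:Z).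

Section Zsum.
Variable (V : nmodType).
Implicit Types (B : nat) (H G : int -> V).

Definition zsupp B H := forall k : int, ~~ (- B%:Z <= k <= B%:Z) -> H k = 0.

Lemma fsbig_zsum (D : set int) B H :
  (forall k : int, - B%:Z <= k <= B%:Z -> D k) ->
  (forall k, D k -> ~~ (- B%:Z <= k <= B%:Z) -> H k = 0) ->
  \sum_(k \in D) H k = zsum B H.
Proof.
move=> DB HB; rewrite (@fsbig_inj V 'I_(2 * B).+1 int D (fun i => i%:Z - B%:Z))//.
- by move=> i j /= ij; apply: val_inj => /=; lia.
- by move=> i; apply: DB; have := ltn_ord i; lia.
move=> x Dx xn; apply: HB => //; apply/negP => xB.
have lt : (absz (x + B%:Z)%R < (2 * B).+1)%N by lia.
by apply: (xn (Ordinal lt)) => /=; lia.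
Qed.

Lemma eq_zsum B H G :
  (forall k : int, - B%:Z <= k <= B%:Z -> H k = G k) -> zsum B H = zsum B G.
Proof.
by move=> HG; apply: eq_bigr => i _; apply: HG; have := ltn_ord i; lia.
Qed.

(** Both sides equal the finitely supported sum over all integers, where a bijection can be applied
    freely; the windows only have to contain the supports. *)
Lemma zsum_reindex B B' (h : int -> int) H :
  bijective h -> zsupp B H -> zsupp B' (H \o h) -> zsum B H = zsum B' (H \o h).
Proof.
move=> bh sH sHh; rewrite -(@fsbig_zsum setT B H)//; last by move=> k _; exact: sH.
rewrite -(@fsbig_zsum setT B' (H \o h))//; last by move=> k _; exact: sHh.
exact: reindex_fsbigT.
Qed.

Lemma zsum_shift (s : int) B B' H :
  zsupp B H -> zsupp B' (fun k => H (k + s)) ->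
  zsum B H = zsum B' (fun k => H (k + s)).
Proof.
move=> sH sHh; apply: (@zsum_reindex B B' (fun k => k + s)) => //.
by exists (fun k => k - s) => k; lia.
Qed.

Lemma zsum_reflect (s : int) B B' H :
  zsupp B H -> zsupp B' (fun k => H (s - k)) ->
  zsum B H = zsum B' (fun k => H (s - k)).
Proof.
move=> sH sHh; apply: (@zsum_reindex B B' (fun k => s - k)) => //.
by exists (fun k => s - k) => k; lia.
Qed.

Lemma zsum_eq0 B H : (forall k : int, H k = 0) -> zsum B H = 0.
Proof. by move=> H0; apply: big1. Qed.

Lemma zsum1 (B : nat) (k0 : int) H : - B%:Z <= k0 <= B%:Z ->
  (forall k, k != k0 -> H k = 0) -> zsum B H = H k0.
Proof.
move=> k0B H0; have lt : (absz (k0 + B%:Z)%R < (2 * B).+1)%N by lia.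
rewrite /zsum (bigD1 (Ordinal lt))//= big1 ?addr0.
  by congr H; lia.
move=> i /eqP ik; apply: H0; apply/eqP => ik0; apply: ik.
by apply: val_inj => /=; lia.
Qed.

Lemma zsumD B H G : zsum B (fun k => H k + G k) = zsum B H + zsum B G.
Proof. exact: big_split. Qed.

Lemma zsum_exchange B B' (H : int -> int -> V) :
  zsum B (fun i => zsum B' (H i)) = zsum B' (fun j => zsum B (H^~ j)).
Proof. exact: exchange_big. Qed.

Lemma zsum_sum B (I : finType) (H : I -> int -> V) :
  \sum_i zsum B (H i) = zsum B (fun k => \sum_i H i k).
Proof. exact: exchange_big. Qed.

Lemma zsum_nat B H : (forall k : int, ~~ (0 <= k <= B%:Z) -> H k = 0) ->
  \sum_(i < B.+1) H i%:Z = zsum B H.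
Proof.
move=> H0; rewrite -(@fsbig_zsum setT B H)//; last first.
  by move=> k _ kB; apply: H0; lia.
rewrite (@fsbig_inj V 'I_B.+1 int setT (fun i => i%:Z))//.
  by move=> i j /= ij; apply: val_inj => /=; lia.
move=> x _ xn; apply: H0; apply/negP => xB.
have lt : (`|x|%N < B.+1)%N by lia.
by apply: (xn (Ordinal lt)) => /=; lia.
Qed.

End Zsum.

Lemma zsumZl (R : pzSemiRingType) B (c : R) (H : int -> R) :
  zsum B (fun k => c * H k) = c * zsum B H.
Proof. exact: (esym (mulr_sumr _ _ _ _)). Qed.

Lemma zsumZr (R : pzSemiRingType) B (c : R) (H : int -> R) :
  zsum B (fun k => H k * c) = zsum B H * c.
Proof. exact: (esym (mulr_suml _ _ _ _)). Qed.

(* A product of [inv_qpoch]s vanishes as soon as one of the indices is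
   negative; otherwise all the indices are nonnegative and [lia] concludes. *)
Ltac vanish :=
  repeat match goal with
  | |- context [@inv_qpoch ?F ?q ?t] =>
      let le := fresh "le" in
      have [le|le] := ltP t 0;
      [ by rewrite (@inv_qpoch_lt0 F q t le) ?(mul0r, mulr0, add0r)
      | move: (@inv_qpoch F q t) => ? ]
  end; try (exfalso; lia).

(** * The q-Chu-Vandermonde sums and the Bailey step *)

Section Vandermonde.
Variables (F : fieldType) (Q : F).
Local Notation w := (inv_qpoch Q).

Lemma qpochS (n : nat) : qpoch Q Q n.+1 = (1 - Q ^+ n.+1) * qpoch Q Q n.
Proof. by rewrite /qpoch big_ord_recr/= -exprS mulrC. Qed.

Lemma inv_qpoch0 : w 0 = 1.
Proof. by rewrite /= /qpoch big_ord0 invr1. Qed.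

Lemma qpochzS (n : int) : 0 < n ->
  qpoch Q Q `|n|%N = (1 - Q ^ n) * qpoch Q Q `|n - 1|%N.
Proof.
case: n => [[|n]|n] // _; rewrite (_ : n.+1%:Z - 1 = n); last lia.
by rewrite !absz_nat qpochS -exprnP.
Qed.

Hypothesis Q1 : forall k : nat, (0 < k)%N -> Q ^+ k != 1.

Lemma qpoch_neq0 (n : nat) : qpoch Q Q n != 0.
Proof.
apply/prodf_neq0 => k _; rewrite subr_eq0 eq_sym -exprS; exact: Q1.
Qed.

(** Holds for every integer: at [n = 0] the factor [1 - Q^0] matches [w (-1) = 0], and below that
    both sides are zero. The recurrences therefore need no boundary terms. *)
Lemma inv_qpoch_pred (n : int) : (1 - Q ^ n) * w n = w (n - 1).
Proof.
case: n => [[|n]|n].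
- by rewrite expr0z subrr mul0r.
- rewrite (_ : n.+1%:Z - 1 = n); last lia.
  rewrite /= qpochS -exprnP invfM mulrA divff ?mul1r//.
  by rewrite subr_eq0 eq_sym Q1.
- by rewrite mulr0 (_ : Negz n - 1 = Negz n.+1); last lia.
Qed.

Lemma qpochK (n : nat) : qpoch Q Q n * w n%:Z = 1.
Proof. by rewrite /= divff ?qpoch_neq0. Qed.

Hypothesis Q0 : Q != 0.

Let subQ_neq0 (n : nat) : 1 - Q ^ n.+1%:Z != 0.
Proof. by rewrite subr_eq0 eq_sym -exprnP Q1. Qed.

(** Write [1 - Q^(A+1) = (1 - Q^(A+1-k)) + Q^(A+1-k) (1 - Q^k)]. The first part lowers the index of
    [w (A+1-k)], the second that of [w k]; shifting [k] by one turns the latter sum into one with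
    [j + 1]. The free weight [v] covers both the full sum and its limit. *)
Lemma vandermonde_rec (B A : nat) (j : int) (v : int -> F) : (A < B)%N ->
  (1 - Q ^ A.+1%:Z) *
    zsum B (fun k => Q ^ (k * (k + j)) * w k * w (k + j) * w (A.+1%:Z - k) * v k)
  = zsum B (fun k => Q ^ (k * (k + j)) * w k * w (k + j) * w (A%:Z - k) * v k)
    + Q ^ (A.+1%:Z + j) *
      zsum B (fun k => Q ^ (k * (k + (j + 1))) * w k * w (k + (j + 1))
                       * w (A%:Z - k) * v (k + 1)).
Proof.
move=> AB; rewrite -!zsumZl.
have -> : zsum B (fun k => Q ^ (A.+1%:Z + j) * (Q ^ (k * (k + (j + 1))) * w k
      * w (k + (j + 1)) * w (A%:Z - k) * v (k + 1)))
    = zsum B (fun k => Q ^ (k * (k + j) + (A.+1%:Z - k)) * w (k - 1) * w (k + j)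
      * w (A.+1%:Z - k) * v k).
  rewrite [RHS](@zsum_shift _ 1 B B) => [|k kB|k kB]; [|by vanish|by vanish].
  apply: eq_zsum => k _; rewrite addrK -addrA [1 + j]addrC.
  rewrite (_ : A.+1%:Z - (k + 1) = A%:Z - k); last lia.
  rewrite !mulrA -expfzDr//; do 4!congr (_ * _); congr (Q ^ _).
  by rewrite intS; ring.
rewrite -zsumD; apply: eq_zsum => k _.
rewrite (_ : A%:Z - k = A.+1%:Z - k - 1); last lia.
rewrite -!inv_qpoch_pred (expfzDr (k * (k + j)))//.
have -> : Q ^ A.+1%:Z = Q ^ (A.+1%:Z - k) * Q ^ k by rewrite -expfzDr// subrK.
ring.
Qed.

(** Induction on [A] for all [p] and [j]: the closed forms obey the same recurrence because [(1 -
    Q^(A+1+j)) + Q^(A+1+j) (1 - Q^p) = 1 - Q^(A+1+p+j)]. The absolute value is harmless: for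
    [A >= 0] and [A + p + j < 0] the factor [w (p + j)] is zero. *)
Lemma vandermonde (B : nat) (A p j : int) : A <= B%:Z ->
  zsum B (fun k => Q ^ (k * (k + j)) * w k * w (k + j) * w (A - k) * w (p - k))
  = qpoch Q Q `|(A + p + j)%R|%N * w A * w p * w (A + j) * w (p + j).
Proof.
case: A => [A|A] AB; last by rewrite [RHS]/= mulr0 !mul0r zsum_eq0// => k; vanish.
elim: A => [|A IH] in p j AB *.
  rewrite (@zsum1 _ _ 0) => [||k k0]; [|lia|by vanish].
  rewrite mul0r expr0z !add0r !subr0 inv_qpoch0 !mul1r mulr1.
  have [p0|p0] := ltP p 0; first by rewrite (inv_qpoch_lt0 _ p0) !(mulr0, mul0r).
  have [j0|j0] := ltP j 0; first by rewrite (inv_qpoch_lt0 _ j0) !(mulr0, mul0r).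
  have := qpochK `|(p + j)%R|%N; rewrite gez0_abs ?addr_ge0// => PK.
  by rewrite -[LHS]mul1r -{1}PK; ring.
apply: (mulfI (subQ_neq0 A));
  rewrite (vandermonde_rec j (fun k => w (p - k)) AB) IH; last lia.
have pE k : p - (k + 1) = p - 1 - k by lia.
under [X in _ + _ * X]eq_zsum => k _ do rewrite pE.
rewrite IH; last lia.
rewrite (_ : A%:Z + (p - 1) + (j + 1) = A%:Z + p + j); last lia.
rewrite (_ : A%:Z + (j + 1) = A.+1%:Z + j); last lia.
rewrite (_ : p - 1 + (j + 1) = p + j); last lia.
(* If [A + 1 + p + j <= 0] then [p + j < 0], and the common factor [w (p + j)] annihilates both
   sides. *)
have [le|ge] := ltP (A.+1%:Z + p + j) 1; first by vanish.
rewrite (@qpochzS (A.+1%:Z + p + j)); last lia.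
rewrite (_ : A.+1%:Z + p + j - 1 = A%:Z + p + j); last lia.
rewrite (_ : A%:Z + j = A.+1%:Z + j - 1); last lia.
rewrite (_ : w A = w (A.+1%:Z - 1)); last by congr w; lia.
rewrite -!inv_qpoch_pred (_ : A.+1%:Z + p + j = A.+1%:Z + j + p); last lia.
rewrite (expfzDr _ p)//; ring.
Qed.

(** A general field offers no limit [p -> oo], so the induction is repeated with weight 1; the
    closed forms now combine by [(1 - Q^(A+1+j)) + Q^(A+1+j) = 1]. *)
Lemma vandermonde_lim (B : nat) (A j : int) : A <= B%:Z ->
  zsum B (fun k => Q ^ (k * (k + j)) * w k * w (k + j) * w (A - k))
  = w A * w (A + j).
Proof.
move=> AB; transitivity (zsum B (fun k =>
    Q ^ (k * (k + j)) * w k * w (k + j) * w (A - k) * 1)).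
  by apply: eq_zsum => k _; rewrite mulr1.
case: A AB => [A|A] AB; last by rewrite [RHS]/= !mul0r zsum_eq0// => k; vanish.
elim: A => [|A IH] in j AB *.
  rewrite (@zsum1 _ _ 0) => [||k k0]; [|lia|by vanish].
  by rewrite mul0r expr0z !add0r oppr0 inv_qpoch0 !mul1r !mulr1.
apply: (mulfI (subQ_neq0 A)); rewrite (vandermonde_rec _ (fun=> 1))// !IH; [|lia|lia].
rewrite (_ : A%:Z + (j + 1) = A.+1%:Z + j); last lia.
rewrite (_ : A%:Z + j = A.+1%:Z + j - 1); last lia.
rewrite (_ : w A = w (A.+1%:Z - 1)); last by congr w; lia.
rewrite -!inv_qpoch_pred; ring.
Qed.

(** For fixed [j] put [r = k + j]. Since [r^2 = k (k + 2j) + j^2], the sum over [k] is the limiting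
    sum with [A = L - j] and shift [2j]. *)
Lemma bailey_step (J : nat) (L : int) (a : int -> F) : L <= J%:Z ->
  zsum J (fun r => Q ^ (r ^+ 2) * w (L - r) *
    zsum J (fun j => a j * w (r - j) * w (r + j)))
  = zsum J (fun j => a j * Q ^ (j ^+ 2) * w (L - j) * w (L + j)).
Proof.
move=> LJ; under eq_zsum => r _ do rewrite -zsumZl.
rewrite zsum_exchange; apply: eq_zsum => j jJ.
(* The window doubles because [k = r - j] can reach [2J]. *)
rewrite (@zsum_shift _ j J (2 * J)) => [|k kB|k kB]; [|by vanish|by vanish].
rewrite (_ : L + j = L - j + 2 * j); last lia.
rewrite -[RHS]mulrA -(@vandermonde_lim (2 * J)); last lia.
rewrite -zsumZl; apply: eq_zsum => k _.
rewrite addrK -addrA -mulr2n -[j *+ 2]mulr_natl.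
rewrite (_ : L - (k + j) = L - j - k); last lia.
rewrite (_ : (k + j) ^+ 2 = k * (k + 2 * j) + j ^+ 2); last ring.
by rewrite expfzDr//; ring.
Qed.

End Vandermonde.

(** * The case [f = 0], by trisection of [1/(q;q)_m] *)

Section Base.
Variables (F : fieldType) (q : F).
Hypothesis q1 : forall k : nat, (0 < k)%N -> q ^+ k != 1.
Hypothesis q0 : q != 0.
Local Notation Q := (q ^+ 3).
Local Notation w := (inv_qpoch Q).

Let Q1 (k : nat) : (0 < k)%N -> Q ^+ k != 1.
Proof. by move=> k0; rewrite -exprM q1// muln_gt0. Qed.

Let Q0 : Q != 0. Proof. by rewrite expf_neq0. Qed.

Lemma exprz_cube (k : int) : Q ^ k = q ^ (3 * k).
Proof. by rewrite exprnP exprz_exp. Qed.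

(** General term of the product of three Euler expansions in base [q^3]. The quadratic form is the
    quadratic part of [3 C(a,2) + 3 C(b,2) + 3 C(c,2) - C(a+b+c,2)]. The linear weights stay free
    because the functional equation changes them. *)
Definition tri_term (x y z a b c : int) : F :=
  q ^ (a ^+ 2 + b ^+ 2 + c ^+ 2 - a * b - b * c - c * a + x * a + y * b + z * c)
  * w a * w b * w c.

Definition tri_sum (B : nat) (x y z m : int) : F :=
  zsum B (fun a => zsum B (fun b => tri_term x y z a b (m - a - b))).

(** Apart from the linear weights the term is symmetric in [a], [b], [c], so relabelling the indices
    rotates the weights. *)
Lemma tri_sum_rot (B : nat) (x y z m : int) : m <= B%:Z ->
  tri_sum B x y z m = tri_sum B y z x m.
Proof.
move=> mB; rewrite /tri_sum zsum_exchange; apply: eq_zsum => b _.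
rewrite (@zsum_reflect _ (m - b) B B) => [|k kB|k kB];
  [|by rewrite /tri_term; vanish|by rewrite /tri_term; vanish].
apply: eq_zsum => a _; rewrite (_ : m - (m - b - a) - b = a); last lia.
have E : forall c, tri_term x y z c b a = tri_term y z x b a c.
  move=> c; rewrite /tri_term -!mulrA; congr (_ * _); last ring.
  by congr (q ^ _); ring.
exact: E.
Qed.

(* Coefficientwise form of [(z;q) = (z;q^3)(zq;q^3)(zq^2;q^3)] (infinite
   products); the recurrence is the functional equation under [z -> zq], which
   permutes the three factors cyclically. *)
Lemma inv_qpoch_trisection (B : nat) (m : int) : m <= B%:Z ->
  inv_qpoch q m = tri_sum B 0 1 (-1) m.
Proof.
case: m => [m|m] mB; last first.
  by rewrite /tri_sum zsum_eq0// => a; rewrite zsum_eq0// => b; rewrite /tri_term; vanish.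
elim: m => [|m IH] in mB *.
  rewrite inv_qpoch0 /tri_sum (@zsum1 _ _ 0) => [||a a0]; [|lia|].
    rewrite (@zsum1 _ _ 0) => [||b b0]; [|lia|by rewrite /tri_term; vanish].
    rewrite /tri_term !subr0 !inv_qpoch0 !mulr1.
    by rewrite [X in q ^ X](_ : _ = 0) ?expr0z//; ring.
  by rewrite zsum_eq0// => b; rewrite /tri_term; vanish.
have nz : 1 - q ^ m.+1%:Z != 0 by rewrite subr_eq0 eq_sym -exprnP q1.
apply: (mulfI nz); rewrite inv_qpoch_pred// (_ : m.+1%:Z - 1 = m); last lia.
rewrite IH; last lia.
rewrite -tri_sum_rot; last lia.
rewrite mulrBl mul1r.
(* Multiplying by [q^(a+b+c)] turns the weights [(0,1,-1)] into [(1,2,0)], a rotation of [(0,1,2)].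
   This differs from [(0,1,-1)] only by [q^(3c)], and the resulting factor [1 - q^(3c)] lowers [w c]
   to [w (c - 1)]. *)
have -> : q ^ m.+1%:Z * tri_sum B 0 1 (-1) m.+1 = tri_sum B 0 1 2 m.+1.
  rewrite [RHS]tri_sum_rot; last lia.
  rewrite /tri_sum -zsumZl; apply: eq_zsum => a _.
  rewrite -zsumZl; apply: eq_zsum => b _.
  rewrite /tri_term !mulrA -expfzDr//; do 3!congr (_ * _).
  by congr (q ^ _); ring.
apply/esym/eqP; rewrite subr_eq; apply/eqP.
rewrite /tri_sum -zsumD; apply: eq_zsum => a _.
rewrite -zsumD; apply: eq_zsum => b _.
rewrite /tri_term (_ : m%:Z - a - b = m.+1%:Z - a - b - 1); last lia.
set c := m.+1%:Z - a - b.
rewrite -(inv_qpoch_pred Q1) exprz_cube.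
set e := (X in q ^ X * w a * w b * w c = _).
rewrite [X in _ = X + _](_ : _ = q ^ e * w a * w b * ((1 - q ^ (3 * c)) * w c));
  last by congr (q ^ _ * _ * _ * _); rewrite /e; ring.
rewrite [X in _ = _ + X](_ : _ = q ^ (e + 3 * c) * w a * w b * w c);
  last by congr (q ^ _ * _ * _ * _); rewrite /e; ring.
by rewrite (expfzDr e)//; ring.
Qed.

(** Divided by [(Q;Q)_(2r)], so that the right side has the form [a_j w(r-j) w(r+j)] on which Bailey
    steps act. *)
Lemma base_identity (B r : nat) : (r <= B)%N ->
  qpoch Q Q r * w (2 * r%:Z) *
    zsum B (fun n => zsum B (fun m =>
      q ^ (2 * m ^+ 2 + 6 * m * n + 6 * n ^+ 2) * inv_qpoch q m * w n
      * w (r%:Z - 2 * n - m)))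
  = zsum B (fun j => q ^ (3 * j ^+ 2 + j) * w (r%:Z - j) * w (r%:Z + j)).
Proof.
move=> rB; set R := r%:Z; have RB : R <= B%:Z by rewrite /R; lia.
(* [G] is the summand after the trisection, with [m = a + b + c]; [K] is what remains once
   [b = c + j] is set and [c] is summed out at fixed [N = n + c]. *)
pose G n a b c := q ^ (2 * (a + b + c) ^+ 2 + 6 * (a + b + c) * n + 6 * n ^+ 2
     + (a ^+ 2 + b ^+ 2 + c ^+ 2 - a * b - b * c - c * a + b - c))
   * w n * w a * w b * w c * w (R - 2 * n - a - b - c).
pose K j a N := q ^ (3 * (a + N) * (a + N + j) + 3 * N * (N + j) + 3 * j ^+ 2 + j)
   * w N * w (N + j) * w a * w (R - 2 * N - j - a).
have S1 : zsum B (fun n => zsum B (fun m =>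
      q ^ (2 * m ^+ 2 + 6 * m * n + 6 * n ^+ 2) * inv_qpoch q m * w n
      * w (R - 2 * n - m)))
    = zsum B (fun n => zsum B (fun a => zsum B (fun b => zsum B (G n a b)))).
  apply: eq_zsum => n _.
  transitivity (zsum B (fun m => zsum B (fun a => zsum B (fun b =>
      q ^ (2 * m ^+ 2 + 6 * m * n + 6 * n ^+ 2) * w n * w (R - 2 * n - m)
      * tri_term 0 1 (-1) a b (m - a - b))))).
    apply: eq_zsum => m /andP[_ mB]; rewrite (inv_qpoch_trisection mB).
    under eq_zsum => a _ do rewrite zsumZl.
    by rewrite zsumZl /tri_sum; ring.
  rewrite zsum_exchange; apply: eq_zsum => a _.
  rewrite zsum_exchange; apply: eq_zsum => b _.
  rewrite (@zsum_shift _ (a + b) B B) => [|k kB|k kB];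
    [|by rewrite /tri_term; vanish|by rewrite /tri_term; vanish].
  apply: eq_zsum => c _; rewrite /tri_term /G.
  rewrite (_ : c + (a + b) - a - b = c); last lia.
  rewrite (_ : R - 2 * n - (c + (a + b)) = R - 2 * n - a - b - c); last lia.
  set e1 := (X in q ^ X * w n * _ * _ = _).
  set e2 := (X in _ * (q ^ X * _ * _ * _) = _).
  rewrite [X in _ = q ^ X * _ * _ * _ * _ * _](_ : _ = e1 + e2);
    last by rewrite /e1 /e2; ring.
  by rewrite (expfzDr e1)//; ring.
have S2 : zsum B (fun n => zsum B (fun a => zsum B (fun b => zsum B (G n a b))))
    = zsum B (fun j => zsum B (fun a => zsum B (fun n => zsum B (fun c =>
        G n a (c + j) c)))).
  transitivity (zsum B (fun n => zsum B (fun a => zsum B (fun j => zsum B (fun c =>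
        G n a (c + j) c))))).
    apply: eq_zsum => n _; apply: eq_zsum => a _.
    rewrite zsum_exchange [RHS]zsum_exchange; apply: eq_zsum => c _.
    rewrite (@zsum_shift _ c B B) => [|k kB|k kB];
      [|by rewrite /G; vanish|by rewrite /G; vanish].
    by apply: eq_zsum => j _; rewrite addrC.
  under eq_zsum => n _ do rewrite zsum_exchange.
  rewrite zsum_exchange; apply: eq_zsum => j _.
  by rewrite zsum_exchange.
(* At fixed [N] the exponent is that of [K] plus [3c(c+j)], so the limiting sum with [A = N] gives
   [w N w(N+j)]. *)
have S3 j : zsum B (fun a => zsum B (fun n => zsum B (fun c => G n a (c + j) c)))
    = zsum B (fun a => zsum B (K j a)).
  apply: eq_zsum => a _; rewrite zsum_exchange.
  transitivity (zsum B (fun c => zsum B (fun N => G (N - c) a (c + j) c))).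
    apply: eq_zsum => c _.
    by rewrite (@zsum_shift _ (- c) B B) => [|k kB|k kB];
      [|by rewrite /G; vanish|by rewrite /G; vanish].
  rewrite zsum_exchange; apply: eq_zsum => N /andP[_ NB].
  transitivity (q ^ (3 * (a + N) * (a + N + j) + 3 * N * (N + j) + 3 * j ^+ 2 + j)
     * w a * w (R - 2 * N - j - a) * (w N * w (N + j))); last by rewrite /K; ring.
  rewrite -(vandermonde_lim Q1 Q0 _ NB) -zsumZl; apply: eq_zsum => c _.
  rewrite /G exprz_cube.
  rewrite (_ : R - 2 * (N - c) - a - (c + j) - c = R - 2 * N - j - a); last lia.
  rewrite [LHS](_ : _ = q ^ ((3 * (a + N) * (a + N + j) + 3 * N * (N + j)
      + 3 * j ^+ 2 + j) + 3 * (c * (c + j)))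
      * (w a * w (R - 2 * N - j - a) * w c * w (c + j) * w (N - c))).
    by rewrite expfzDr//; ring.
  by rewrite -!mulrA; congr (_ * _); [congr (q ^ _); ring|ring].
(* With [p = a + N], the sum over [N] is a full sum with parameters [p] and [R - j - p],
   contributing [(Q;Q)_r]. The remaining sum over [p] is a full sum with parameters [R] and [R - j],
   contributing [(Q;Q)_(2r)]. *)
have S4 j : zsum B (fun a => zsum B (K j a)) =
    q ^ (3 * j ^+ 2 + j) * qpoch Q Q r *
    (qpoch Q Q (2 * r) * w R * w (R - j) * w (R + j) * w R).
  rewrite zsum_exchange.
  transitivity (zsum B (fun N => zsum B (fun p => K j (p - N) N))).
    apply: eq_zsum => N _.
    by rewrite (@zsum_shift _ (- N) B B) => [|k kB|k kB];
      [|by rewrite /K; vanish|by rewrite /K; vanish].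
  rewrite zsum_exchange.
  have := vandermonde Q1 Q0 (R - j) j RB.
  rewrite (_ : R + (R - j) + j = (2 * r)%N); last by rewrite /R; lia.
  rewrite absz_nat subrK => <-.
  rewrite -zsumZl; apply: eq_zsum => p /andP[_ pB].
  transitivity (q ^ (3 * j ^+ 2 + j) * Q ^ (p * (p + j)) *
      zsum B (fun N => Q ^ (N * (N + j)) * w N * w (N + j) * w (p - N)
         * w (R - j - p - N))).
    rewrite -zsumZl; apply: eq_zsum => N _; rewrite /K.
    rewrite (_ : R - 2 * N - j - (p - N) = R - j - p - N); last lia.
    rewrite !exprz_cube !mulrA -!expfzDr//; congr (_ * _ * _ * _ * _).
    by congr (q ^ _); ring.
  rewrite (vandermonde Q1 Q0 _ _ pB).
  rewrite (_ : p + (R - j - p) + j = r); last by rewrite /R; lia.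
  rewrite absz_nat (_ : R - j - p + j = R - p); last lia.
  ring.
rewrite S1 S2 -zsumZl; apply: eq_zsum => j _; rewrite S3 S4.
have Pr := qpochK Q1 r; have P2r := qpochK Q1 (2 * r).
rewrite -/R in Pr; rewrite PoszM -/R in P2r.
transitivity (q ^ (3 * j ^+ 2 + j) * w (R - j) * w (R + j) *
   (qpoch Q Q r * w R) ^+ 2 * (qpoch Q Q (2 * r) * w (2 * R))); first ring.
by rewrite Pr P2r expr1n !mulr1.
Qed.

End Base.

(** * Sums over tuples and iteration of the Bailey step *)

Lemma big_tupleS (V : nmodType) (T : finType) n (G : seq T -> V) :
  \sum_(t : n.+1.-tuple T) G t = \sum_(x : T) \sum_(t : n.-tuple T) G (x :: t).
Proof.
rewrite pair_bigA/= (reindex (fun p : T * n.-tuple T => [tuple of p.1 :: p.2]))//.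
exists (fun t : n.+1.-tuple T => (thead t, [tuple of behead t])) => [[x t] _|t _] /=.
  by congr (_, _); apply: val_inj.
by rewrite [RHS]tuple_eta.
Qed.

Lemma big_tuple1 (V : nmodType) (T : finType) (G : seq T -> V) :
  \sum_(t : 1.-tuple T) G t = \sum_(x : T) G [:: x].
Proof.
rewrite big_tupleS; apply: eq_bigr => x _.
by rewrite (big_pred1 [tuple])// => t; apply/esym/eqP; exact: tuple0.
Qed.

Section Chain.
Variables (F : fieldType) (Q : F).
Local Notation w := (inv_qpoch Q).

(** The part of the summand governed by [n_1, ..., n_f]: [N_i] is the sum of the current suffix, and
    the last entry carries [g] in place of [w]. The recursion exposes the head, as a Bailey step
    requires; the empty list only receives a default value, since [f > 0]. *)
Fixpoint chain (g : nat -> F) (s : seq nat) : F :=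
  match s with
  | [::] => 0
  | [:: x] => Q ^+ (x ^ 2) * g x
  | x :: s' => Q ^+ (sumn s ^ 2) * w x%:Z * chain g s'
  end.

Lemma chain_sum (I : finType) (g : I -> nat -> F) s :
  chain (fun x => \sum_i g i x) s = \sum_i chain (g i) s.
Proof.
elim: s => [|x [|y s] IH]; first by rewrite big1.
  by rewrite /= mulr_sumr.
by rewrite /= in IH *; rewrite IH mulr_sumr.
Qed.

Lemma tail_sum1 n (t : n.-tuple nat) : tail_sum t 1 = sumn t.
Proof. by rewrite /tail_sum /part big_add1/= sumnE [RHS](big_nth 0%N) size_tuple. Qed.

Lemma tail_sum_cons n x (t : n.-tuple nat) i :
  tail_sum [tuple of x :: t] i.+2 = tail_sum t i.+1.
Proof.
rewrite /tail_sum big_add1/=; apply: eq_big_nat => k /andP[ik _].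
by rewrite /part; case: k ik.
Qed.

Lemma chainE (g : nat -> F) n (t : n.+1.-tuple nat) :
  Q ^+ (\sum_(1 <= i < n.+2) tail_sum t i ^ 2)
  * \prod_(1 <= i < n.+1) w (part t i)%:Z * g (part t n.+1) = chain g t.
Proof.
elim: n t => [|n IH] t.
  rewrite big_nat1 big_geq// mulr1 tail_sum1 /part.
  by case/tupleP: t => x t; rewrite (tuple0 t) /= addn0.
case/tupleP: t => x t.
rewrite [RHS](_ : _ = Q ^+ (sumn (x :: t) ^ 2) * w x%:Z * chain g t); last first.
  by case/tupleP: t => y t.
rewrite big_ltn// [\prod_(_ <= _ < _) _]big_ltn//.
rewrite big_add1 [\prod_(_ <= _ < _) _]big_add1 -!pred_Sn.
rewrite -IH exprD tail_sum1.
rewrite (eq_big_nat _ _ (F2 := fun i => (tail_sum t i ^ 2)%N)); last first.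
  by case=> // i _; rewrite tail_sum_cons.
rewrite [\prod_(_ <= _ < _) _](eq_big_nat _ _ (F2 := fun i => w (part t i)%:Z));
  last by case.
have -> : part [tuple of x :: t] n.+2 = part t n.+1 by [].
have -> : part [tuple of x :: t] 1 = x by [].
have -> : sumn [tuple of x :: t] = sumn (x :: t) by [].
move: (sumn _ ^ 2)%N => e1.
ring.
Qed.

Lemma exprz_sqr (x : nat) : Q ^ (x%:Z ^+ 2) = Q ^+ (x ^ 2)%N.
Proof. by rewrite expr2 -PoszM -exprnP mulnn. Qed.

Hypothesis Q1 : forall k : nat, (0 < k)%N -> Q ^+ k != 1.
Hypothesis Q0 : Q != 0.

(** Each further entry is one Bailey step. If [x] is the head, [N] the sum of the tail and
    [r = x + N], then [w x = w (r - N)] is the factor needed for the induction hypothesis at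
    [L = r]. *)
Lemma bailey_chain (J n : nat) (L : int) (a : int -> F) (g : nat -> F) :
  L <= J%:Z ->
  (forall x : nat, (x <= J)%N ->
     g x = zsum J (fun j => a j * w (x%:Z - j) * w (x%:Z + j))) ->
  \sum_(t : n.+1.-tuple 'I_J.+1)
     w (L - (sumn (map val t))%:Z) * chain g (map val t)
  = zsum J (fun j => a j * Q ^ (n.+1%:Z * j ^+ 2) * w (L - j) * w (L + j)).
Proof.
move=> LJ gE; elim: n L LJ => [|n IH] L LJ.
  rewrite (big_tuple1 (fun t => w (L - (sumn (map val t))%:Z) * chain g (map val t))).
  under [RHS]eq_zsum => j _ do rewrite mul1r.
  rewrite -(bailey_step Q1 Q0 _ LJ) -zsum_nat => [|k kJ].
    apply: eq_bigr => x _; rewrite exprz_sqr -(gE _ (leq_ord x)).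
    by rewrite /chain /= addn0; move: (_ ^ 2)%N => e; ring.
  by rewrite -zsumZl zsum_eq0// => j; vanish.
rewrite (big_tupleS _
  (fun t => w (L - (sumn (map val t))%:Z) * chain g (map val t))).
(* One [Q^(j^2)] is split off as the output of the outermost Bailey step. *)
have QE (j : int) : Q ^ (n.+2%:Z * j ^+ 2) = Q ^ (n.+1%:Z * j ^+ 2) * Q ^ (j ^+ 2).
  by rewrite -expfzDr// (intS n.+1); congr (Q ^ _); ring.
under [RHS]eq_zsum => j _ do rewrite QE mulrA.
rewrite -(bailey_step Q1 Q0 _ LJ).
under [RHS]eq_zsum => r /andP[_ rJ] do rewrite -IH// mulr_sumr.
rewrite -zsum_sum exchange_big; apply: eq_bigr => t _.
pose N := sumn (map val t).
transitivity (zsum J (fun x => w (L - (x + N%:Z)) * Q ^ ((x + N%:Z) ^+ 2) * w x)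
   * chain g (map val t)).
  rewrite -zsum_nat => [|k kJ]; last by vanish.
  rewrite mulr_suml; apply: eq_bigr => x _.
  have -> : chain g (map val (x :: t))
      = Q ^+ (sumn (map val (x :: t)) ^ 2) * w (val x)%:Z * chain g (map val t).
    by case/tupleP: t @N => y t.
  rewrite -PoszD exprz_sqr; have -> : sumn (map val (x :: t)) = (x + N)%N by [].
  by move: (_ ^ 2)%N => e; ring.
rewrite (@zsum_shift _ (- N%:Z) J J) => [|k kB|k kB]; [|by vanish|by vanish].
rewrite -zsumZr; apply: eq_zsum => r _.
by rewrite subrK; ring.
Qed.

End Chain.

(** * Assembly of the identity, with [q = 0] treated separately *)

Section Main.
Variables (F : fieldType) (q : F).
Local Notation Q := (q ^+ 3).
Local Notation w := (inv_qpoch Q).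

(** All factors involving [m], [n] or [n_f] go into the end function of the chain, except that [n_f]
    also enters through the [N_i]. *)
Lemma summand_chain (L m n f : nat) (s : f.+1.-tuple nat) :
  summand q L m n s = qpoch Q Q (2 * L) * (w (L%:Z - (sumn s)%:Z) *
    chain Q (fun x => q ^+ (2 * m ^ 2 + 6 * m * n + 6 * n ^ 2) * qpoch Q Q x
      * inv_qpoch q m%:Z * w n%:Z * w (x%:Z - 2 * n%:Z - m%:Z) * w (2 * x)%N%:Z) s).
Proof.
rewrite -chainE /summand tail_sum1 exprD exprM.
move: (_ + 6 * n ^ 2)%N (\sum_(1 <= i < f.+2) _)%N => e e'.
move: (\prod_(1 <= i < f.+1) _) => P; ring.
Qed.

Lemma qbinom_central (L : nat) (j : int) : - L%:Z <= j <= L%:Z ->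
  qbinom Q (2 * L%:Z) (L%:Z - j)
  = qpoch Q Q (2 * L) * (w (L%:Z - j) * w (L%:Z + j)).
Proof.
move=> jL; have [x Ex] : exists x : nat, L%:Z - j = x.
  by exists (absz (L%:Z - j)%R); lia.
have [y Ey] : exists y : nat, L%:Z + j = y by exists (absz (L%:Z + j)%R); lia.
rewrite Ex Ey /qbinom (_ : 2 * L%:Z - x%:Z = y%:Z); last lia.
by rewrite /= invfM (_ : (x + y = 2 * L)%N)//; lia.
Qed.

Lemma summand_fsbig (L f : nat) : (0 < f)%N ->
  \sum_(x \in [set: nat * nat * f.-tuple nat]) summand q L x.1.1 x.1.2 x.2
  = \sum_(t : f.-tuple 'I_L.+1) \sum_(m < L.+1) \sum_(n < L.+1)
      summand q L m n (map_tuple val t).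
Proof.
move=> f0.
pose h (y : 'I_L.+1 * 'I_L.+1 * f.-tuple 'I_L.+1) : nat * nat * f.-tuple nat :=
  (val y.1.1, val y.1.2, map_tuple val y.2).
rewrite (@fsbig_inj _ _ _ _ h)//.
- under [RHS]eq_bigr => t _ do rewrite pair_bigA.
  by rewrite exchange_big pair_bigA.
- move=> [[m n] t] [[m' n'] t'] [/val_inj-> /val_inj-> tt'].
  by congr (_, _); apply: val_inj; apply: inj_map tt'; apply: val_inj.
move=> [[m n] s] _ hn; apply/eqP; apply: contrapT => /negP nz.
have [mL nL sL] := summand_neq0 f0 nz.
apply: (hn (inord m, inord n, map_tuple (@inord L) s)).
congr (_, _, _); rewrite /= ?inordK//; apply: val_inj => /=.
rewrite -map_comp -[RHS]map_id; apply/eq_in_map => x /sL xL /=.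
by rewrite inordK.
Qed.

(** At [q = 0] every q-Pochhammer symbol is 1 and [q^e] survives only for [e = 0]. The exponent on
    the left contains [2m^2 + 6n^2 + 3N_1^2], which leaves only zero indices; on the right only
    [j = 0] is left. *)
Lemma theorem14_eq0 (L f : nat) : q = 0 -> (0 < f)%N ->
  \sum_(x \in [set: nat * nat * f.-tuple nat]) summand q L x.1.1 x.1.2 x.2
  = \sum_(j \in [set j : int | - L%:Z <= j <= L%:Z])
      q ^ (3 * (f%:Z + 1) * j ^+ 2 + j) * qbinom Q (2 * L%:Z) (L%:Z - j).
Proof.
move=> q0 f0.
have P1 n : qpoch Q Q n = 1.
  by apply: big1 => k _; rewrite q0 expr0n mul0r subr0.
have p1 n : qpoch q q n = 1.
  by apply: big1 => k _; rewrite q0 mul0r subr0.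
have w1 n : w n%:Z = 1 by rewrite /= P1 invr1.
have pos (e : nat) : e != 0%N -> q ^+ e = 0.
  by move=> /negPf e0; rewrite q0 expr0n e0.
rewrite (@fsbig_inj _ 'I_1 _ _ (fun=> (0%N, 0%N, nseq_tuple f 0%N)))
  => [|i j _|//|]; first last.
- move=> [[m n] s] _ /(_ ord0) ne; rewrite /summand.
  set e := (X in q ^+ X * _ * _ * _).
  have [e0|/pos->] := eqVneq e 0%N; last by rewrite !mul0r.
  exfalso; apply: ne; move: e0; rewrite /e big_ltn// tail_sum1.
  move: (\sum_(2 <= i < f.+1) _)%N => S e0.
  have sqr0 k : (k ^ 2 == 0 -> k = 0)%N by rewrite expn_eq0 andbT => /eqP.
  have [/sqr0 m0 /sqr0 n0 /sqr0 s0] : [/\ m ^ 2 == 0, n ^ 2 == 0 & sumn s ^ 2 == 0]%N.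
    move: e0; rewrite -mulnA; move: (m * n)%N (m ^ 2)%N (n ^ 2)%N (sumn s ^ 2)%N.
    by move=> a b c d e0; split; lia.
  rewrite m0 n0.
  congr (_, _); apply: val_inj; transitivity (nseq (size s) 0%N).
    by rewrite size_tuple.
  by apply/esym/natnseq0P; rewrite s0.
- by rewrite (ord1 i) (ord1 j).
have expo_gt0 (j : int) : j <> 0 -> 0 < 3 * (f%:Z + 1) * j ^+ 2 + j.
  move=> j0; have jj : 0 < j * j by nia.
  have fjj : 0 <= f%:Z * (j * j) by rewrite mulr_ge0// ltW.
  have jj1 : 0 <= j * j + j by nia.
  (* Three nonnegative summands, the middle one positive for nonzero [j]. *)
  have -> : 3 * (f%:Z + 1) * j ^+ 2 + j
    = (j * j + j) + 2 * (j * j) + 3 * (f%:Z * (j * j)) by ring.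
  move: (j * j) fjj jj jj1 => x; move: (f%:Z * x) => y; lia.
rewrite (@fsbig_inj _ 'I_1 int _ (fun=> 0)) => [|i j _||]//; first last.
- move=> j jL /(_ ord0) j0; have := expo_gt0 j (nesym j0).
  set e := (X in q ^ X); rewrite -/e; case: e => [[|e]|e]// _.
  by rewrite -exprnP (pos e.+1)// mul0r.
- by move=> _ /=; lia.
- by rewrite (ord1 i) (ord1 j).
rewrite !big_ord1.
have part0 i : part (nseq_tuple f 0%N) i = 0%N.
  by rewrite /part nth_nseq if_same.
have tail0 i : tail_sum (nseq_tuple f 0%N) i = 0%N by apply: big1.
rewrite (@qbinom_central L 0); last lia.
rewrite expr0n mulr0 !(subr0, addr0) expr0z !w1 P1 !mulr1.
rewrite /summand /= part0 tail0 !p1 !P1 !w1 big1 ?big1 => [|i _|i _].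
- by rewrite !invr1 !mulr1.
- by rewrite P1 invr1.
- by rewrite tail0.
Qed.

Hypothesis q1 : forall k : nat, (0 < k)%N -> q ^+ k != 1.

Lemma theorem14_neq0 (L f : nat) : q != 0 -> (0 < f)%N ->
  \sum_(x \in [set: nat * nat * f.-tuple nat]) summand q L x.1.1 x.1.2 x.2
  = \sum_(j \in [set j : int | - L%:Z <= j <= L%:Z])
      q ^ (3 * (f%:Z + 1) * j ^+ 2 + j) * qbinom Q (2 * L%:Z) (L%:Z - j).
Proof.
move=> q0 f0; rewrite summand_fsbig//; case: f f0 => // f _.
have Q1 k : (0 < k)%N -> Q ^+ k != 1.
  by move=> k0; rewrite -exprM q1// muln_gt0.
have Q0 : Q != 0 by rewrite expf_neq0.
rewrite (@fsbig_zsum _ _ L)//; last by move=> k /= ->.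
pose g (p : 'I_L.+1 * 'I_L.+1) (x : nat) : F :=
  q ^+ (2 * p.1 ^ 2 + 6 * p.1 * p.2 + 6 * p.2 ^ 2) * qpoch Q Q x
  * inv_qpoch q (val p.1)%:Z * w (val p.2)%:Z
  * w (x%:Z - 2 * (val p.2)%:Z - (val p.1)%:Z) * w (2 * x)%N%:Z.
(* The chain is linear in its end function, so the sums over [m] and [n] move inside, where they
   form the left side of the case [f = 0]. *)
transitivity (qpoch Q Q (2 * L) * \sum_(t : f.+1.-tuple 'I_L.+1)
    w (L%:Z - (sumn (map val t))%:Z) * chain Q (fun x => \sum_p g p x) (map val t)).
  rewrite mulr_sumr; apply: eq_bigr => t _.
  rewrite chain_sum !mulr_sumr pair_bigA; apply: eq_bigr => -[m n] _.
  exact: summand_chain.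
(* Here [f] is one less than in the statement: its [f + 1] steps multiply [a_j = q^(3j^2+j)] by
   [q^(3(f+1)j^2)]. *)
rewrite (@bailey_chain _ _ Q1 Q0 L f _ (fun j => q ^ (3 * j ^+ 2 + j)))//.
  rewrite -zsumZl; apply: eq_zsum => j jL; rewrite qbinom_central//.
  rewrite exprz_cube//.
  have -> : 3 * (f.+1%:Z + 1) * j ^+ 2 + j = (3 * j ^+ 2 + j) + 3 * (f.+1%:Z * j ^+ 2).
    by ring.
  rewrite (expfzDr (3 * j ^+ 2 + j))//; ring.
move=> x xL; rewrite -(base_identity q1 q0 xL).
rewrite -zsum_nat => [|k kL]; last first.
  by rewrite zsum_eq0// => m; vanish.
rewrite mulr_sumr -(pair_bigA _ (fun m n => g (m, n) x)) exchange_big.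
apply: eq_bigr => n _; rewrite -zsum_nat => [|k kL]; last by vanish.
rewrite mulr_sumr; apply: eq_bigr => m _; rewrite /g.
rewrite (_ : 2 * x%:Z = (2 * x)%N%:Z); last lia.
rewrite [X in q ^ X](_ : _ = (2 * m ^ 2 + 6 * m * n + 6 * n ^ 2)%N%:Z); last by lia.
rewrite -exprnP [(m, n).1]/= [(m, n).2]/=.
move: (_ + 6 * n ^ 2)%N => e; ring.
Qed.

End Main.

Unset Implicit Arguments.

Theorem theorem14 (F : fieldType) (q : F)
    (hq : forall k : nat, (0 < k)%N -> q ^+ k != 1)
    (L f : nat) (hf : (0 < f)%N) :
  \sum_(x \in [set: nat * nat * f.-tuple nat]) summand q L x.1.1 x.1.2 x.2
  = \sum_(j \in [set j : int | - L%:Z <= j <= L%:Z])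
      q ^ (3 * (f%:Z + 1) * j ^+ 2 + j) * qbinom (q ^+ 3) (2 * L%:Z) (L%:Z - j).
Proof.
have [q0|q0] := eqVneq q 0; first exact: theorem14_eq0.
exact: theorem14_neq0.
Qed.
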